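(* Let $\alpha,\beta,\gamma,\delta$ be positive real numbers with $\beta>2\gamma+3\alpha$, $\gamma>2\alpha$ and $\delta\ge1$. Define $A:[0,\infty)\to\mathbb R^{2\times2}$ by $$A(t)=\begin{pmatrix} -\alpha & \delta \\ 0 & -\beta \end{pmatrix}\ \text{ if } t\in[0,1)\text{ or } 2^{2k+1}\le t<2^{2k+2}\text{ for some }k\in\mathbb N_0,$$ $$A(t)=\begin{pmatrix} -\alpha & \delta \\ 0 & \gamma \end{pmatrix}\ \text{ if } 2^{2k}\le t<2^{2k+1}\text{ for some }k\in\mathbb N_0 .$$ Then the trivial solution of the perturbed system $$\begin{pmatrix} \dot x \\ \dot y \end{pmatrix}=A(t)\begin{pmatrix} x \\ y \end{pmatrix}+\begin{pmatrix} 0 \\ x^2 \end{pmatrix}$$ is unstable.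
   Context: Solutions are absolutely continuous functions satisfying the equation for almost every $t$. Unstable means not Lyapunov stable: it is not true that for every $\varepsilon>0$ there is $\eta>0$ such that every solution starting at time $0$ in the ball of radius $\eta$ around the origin exists for all $t\ge0$ and stays in the ball of radius $\varepsilon$. *)

(* Defs.v *)
From HB Require Import structures.
From mathcomp Require Import all_boot all_order all_algebra.
From mathcomp Require Import all_classical all_reals all_analysis.
Set Implicit Arguments.
Unset Strict Implicit.
Unset Printing Implicit Defensive.
Import Order.TTheory GRing.Theory Num.Theory.
Import numFieldNormedType.Exports.
Local Open Scope classical_set_scope.
Local Open Scope ring_scope.

Definition abs_continuous_on {R : realType} {V : normedModType R}
    (a b : R) (f : R -> V) : Prop :=
  forall e : R, 0 < e -> exists2 d : R, 0 < d &
    forall (n : nat) (l r : 'I_n -> R),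
      (forall i, [/\ a <= l i, l i <= r i & r i <= b]) ->
      trivIset setT (fun i => `]l i, r i[%classic) ->
      \sum_(i < n) (r i - l i) < d ->
      \sum_(i < n) `|f (r i) - f (l i)| < e.

(* The library norm on matrices is the maximum norm. *)
Definition euclidean_norm {R : realType} {n : nat} (v : 'cV[R]_n) : R :=
  Num.sqrt (\sum_(i < n) v i 0 ^+ 2).

Definition time_interval {R : realType} (b : \bar R) : set R :=
  [set t | 0 <= t /\ (t%:E < b)%E].

(* [z] solves z' = F t z on [0, b[, with b = +oo allowed.  Values of [z]
   outside [0, b[ are irrelevant: they only affect the two-sided derivative
   at t = 0, which is a null set. *)
Definition solution_on {R : realType} {n : nat}
    (F : R -> 'cV[R]_n.+1 -> 'cV[R]_n.+1)
    (b : \bar R) (z : R -> 'cV[R]_n.+1) : Prop :=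
  [/\ (0 < b)%E,
      forall c : R, time_interval b c -> abs_continuous_on 0 c z
    & {ae lebesgue_measure, forall t : R,
        time_interval b t -> is_derive t 1 z (F t (z t))}].

Definition maximal_solution_on {R : realType} {n : nat}
    (F : R -> 'cV[R]_n.+1 -> 'cV[R]_n.+1)
    (b : \bar R) (z : R -> 'cV[R]_n.+1) : Prop :=
  solution_on F b z /\
  forall (b' : \bar R) (w : R -> 'cV[R]_n.+1),
    solution_on F b' w -> (b <= b')%E ->
    (forall t, time_interval b t -> w t = z t) -> b' = b.

(* "Every solution exists for all t >= 0" is expressed by saying that every
   maximal solution has b = +oo. *)
Definition lyapunov_stable {R : realType} {n : nat}
    (F : R -> 'cV[R]_n.+1 -> 'cV[R]_n.+1) : Prop :=
  forall e : R, 0 < e -> exists2 eta : R, 0 < eta &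
    forall (b : \bar R) (z : R -> 'cV[R]_n.+1),
      maximal_solution_on F b z -> euclidean_norm (z 0) < eta ->
      b = +oo%E /\ forall t : R, 0 <= t -> euclidean_norm (z t) < e.

Definition unstable {R : realType} {n : nat}
    (F : R -> 'cV[R]_n.+1 -> 'cV[R]_n.+1) : Prop :=
  ~ lyapunov_stable F.

Definition mx22 {R : realType} (a b c d : R) : 'M[R]_2 :=
  \matrix_(i < 2, j < 2)
    if i == 0 then (if j == 0 then a else b) else (if j == 0 then c else d).

Definition cv2 {R : realType} (a b : R) : 'cV[R]_2 :=
  \col_(i < 2) if i == 0 then a else b.

Definition contracting_time {R : realType} (t : R) : Prop :=
  0 <= t < 1 \/
  exists k : nat, 2 ^+ (2 * k + 1)%N <= t < 2 ^+ (2 * k + 2)%N.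

Definition expanding_time {R : realType} (t : R) : Prop :=
  exists k : nat, 2 ^+ (2 * k)%N <= t < 2 ^+ (2 * k + 1)%N.

(* The two kinds of times partition [0, +oo[; the value 0 is taken only for
   t < 0, where the equation is never considered. *)
Definition coef_mx {R : realType} (alpha beta gamma delta t : R) : 'M[R]_2 :=
  if `[< contracting_time t >] then mx22 (- alpha) delta 0 (- beta)
  else if `[< expanding_time t >] then mx22 (- alpha) delta 0 gamma
  else 0.

Definition perturbed_rhs {R : realType} (alpha beta gamma delta t : R)
    (v : 'cV[R]_2) : 'cV[R]_2 :=
  coef_mx alpha beta gamma delta t *m v + cv2 0 (v 0 0 ^+ 2).

(* Main.v *)
Require Import Defs.
From mathcomp Require Import all_boot all_order all_algebra.
From mathcomp Require Import all_classical all_reals all_analysis.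
From mathcomp Require Import measurable_realfun.
From mathcomp Require Import ring lra zify.
Set Implicit Arguments.
Unset Strict Implicit.
Unset Printing Implicit Defensive.
Import Order.TTheory GRing.Theory Num.Theory.
Import numFieldNormedType.Exports.
Local Open Scope ring_scope.

(** The coordinate [y] of a solution starting at (x0, 0) with x0 > 0 is pumped
up by the term x^2 faster than the system can damp it.  Write T = 2^(2k).

While the solution exists, y' = c(t) y + x^2 >= c(t) y, so y stays nonnegative,
and then x' = - alpha x + delta y >= - alpha x gives x(t) >= x0 e^(- alpha t).
On the expanding interval [T, 2T] this yields
y' >= gamma y + x0^2 e^(- 2 alpha t), and integrating from y(T) >= 0,
y(2T) >= x0^2 / (gamma + 2 alpha) (e^((gamma - 2 alpha) T) - e^(- 4 alpha T)),
which is unbounded in k because gamma > 2 alpha.  Hence no solution of this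
kind, however small x0 is, stays in the unit ball for all times
([solution_unbounded]).

Solutions being only absolutely continuous, these differential inequalities
are integrated with [abs_continuous_expR_comparison], which rests on the fact
that an absolutely continuous function with almost everywhere nonnegative
derivative is nondecreasing ([abs_continuous_ge0_nondecreasing]).

Stability speaks about maximal solutions only, so one must be produced for
arbitrarily small x0.  The coefficients are constant on [0, 1), so the Taylor
series computed from the equation has geometrically bounded coefficients and
solves it near 0 ([local_solution]); Zorn's lemma extends this solution to a
maximal one ([maximal_extension]).  Stability would make the latter global and
bounded, a contradiction. *)

(** * Absolutely continuous functions with nonnegative derivative *)

(** Cousin's lemma, by real induction: the local hypothesis at the supremum of the
points reachable from [a] carries the property across that supremum. *)
Lemma interval_induction (R : realType) (P : R -> R -> Prop) (a b : R) :
  a <= b ->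
  (forall u v w, a <= u -> u <= v -> v <= w -> w <= b ->
     P u v -> P v w -> P u w) ->
  (forall x, a <= x -> x <= b -> exists2 d, 0 < d &
     forall u v, a <= u -> u <= x -> x <= v -> v <= b ->
       x - d < u -> v < x + d -> P u v) ->
  P a b.
Proof.
move=> ab Padd Ploc.
pose S : set R := [set t | [/\ a <= t, t <= b & P a t]]%classic.
have Sa : S a.
  split => //; have [d d0 Pd] := Ploc a (lexx a) ab.
  by apply: Pd => //; rewrite ?ltrBlDr ?ltrDl.
have supS : has_sup S by split; [exists a|exists b => t []].
have aS : a <= sup S by apply: ub_le_sup => //; case: supS.
have Sb : sup S <= b by apply: ge_sup; [exists a|move=> t []].
have [d d0 Pd] := Ploc _ aS Sb.
have [t [at_ tb Pat] dt] := sup_adherent d0 supS.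
have tS : t <= sup S by apply: ub_le_sup => //; case: supS.
pose v := Num.min b (sup S + d / 2).
have Sv : sup S <= v by rewrite /v le_min Sb lerDl divr_ge0// ltW.
have vb : v <= b by rewrite /v ge_min lexx.
have Pav : P a v.
  apply: (Padd _ t) => //; first exact: le_trans tS Sv.
  apply: Pd => //.
  by rewrite /v gt_min ltrD2l ltr_pdivrMr// ltr_pMr// ltr1n orbT.
have vS : v <= sup S.
  by apply: ub_le_sup; [case: supS|split => //; exact: le_trans Sv].
suff <- : v = b by [].
apply/eqP; rewrite eq_le vb/=.
move: vS; rewrite {1}/v ge_min => /orP[bS|]; first exact: le_trans Sv.
by rewrite gerDl leNgt divr_gt0.
Qed.

Lemma sum_disjoint_lengths_le (R : realType) (n : nat) (l r : 'I_n -> R)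
    (U : set R) :
  measurable U -> (forall i, l i <= r i) ->
  (forall i, `]l i, r i[ `<=` U)%classic ->
  trivIset setT (fun i => `]l i, r i[%classic) ->
  ((\sum_(i < n) (r i - l i))%:E <= lebesgue_measure U)%E.
Proof.
move=> mU lr lrU tlr.
have mI (i : 'I_n) : measurable (`]l i, r i[%classic : set R) by [].
apply: (@le_trans _ _ (lebesgue_measure
   (\big[setU/set0]_(i < n) `]l i, r i[%classic : set R)%classic)).
  rewrite measure_bigsetU_ord// -sumEFin; apply: lee_sum => i _.
  change ((r i - l i)%:E <= @lebesgue_measure R `]l i, r i[%classic)%E.
  rewrite lebesgue_measure_itv/= lte_fin; case: ifPn => //.
  by rewrite -leNgt lee_fin subr_le0.
apply: le_measure; rewrite ?inE//.
- by apply: bigsetU_measurable.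
- by apply: (big_ind (fun A : set R => A `<=` U)%classic) => // A B AU BU x [/AU|/BU].
Qed.

(** Absolute continuity quantifies over families indexed by ordinals; the
covering argument concatenates lists of intervals, sorted from left to right,
and this converts one into the other. *)
Lemma abs_continuous_sorted_seq (R : realType) (f : R -> R) (a b e d : R)
    (U : set R) (s : seq (R * R)) :
  (forall (n : nat) (l r : 'I_n -> R),
      (forall i, [/\ a <= l i, l i <= r i & r i <= b]) ->
      trivIset setT (fun i => `]l i, r i[%classic) ->
      \sum_(i < n) (r i - l i) < d ->
      \sum_(i < n) `|f (r i) - f (l i)| < e) ->
  measurable U -> (lebesgue_measure U < d%:E)%E ->
  (forall p, p \in s -> [/\ a <= p.1, p.1 <= p.2, p.2 <= b
     & `]p.1, p.2[ `<=` U]%classic) ->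
  pairwise (fun p q : R * R => p.2 <= q.1) s ->
  \sum_(p <- s) `|f p.2 - f p.1| < e.
Proof.
move=> acf mU Ud sU /(pairwiseP (0, 0)) sS.
rewrite (big_nth (0, 0)) big_mkord.
have nthU (i : 'I_(size s)) := sU _ (mem_nth (0, 0) (ltn_ord i)).
have tI : trivIset setT
    (fun i : 'I_(size s) => `](nth (0, 0) s i).1, (nth (0, 0) s i).2[%classic).
  apply/trivIsetP => i j _ _; wlog ij : i j / (i < j)%N.
    move=> H ij; have [|ji|/val_inj ij'] := ltngtP i j; first by move/H; apply.
      by rewrite setIC H// eq_sym.
    by rewrite ij' eqxx in ij.
  move=> _; rewrite -subset0 => x []/=; rewrite !in_itv/= => /andP[_ xi] /andP[xj _].
  have := sS i j (ltn_ord i) (ltn_ord j) ij.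
  by rewrite leNgt (lt_trans xj xi).
apply: acf => // [i|]; first by have [] := nthU i.
rewrite -lte_fin; apply: le_lt_trans Ud.
by apply: sum_disjoint_lengths_le => // i; have [] := nthU i.
Qed.


(** The interval [u, v] straddles [x]: a derivative only controls increments
from [x] itself, to the left and to the right. *)
Lemma derive_ge0_local (R : realType) (f : R -> R) (x df e : R) :
  is_derive x 1 f df -> 0 <= df -> 0 < e ->
  exists2 d, 0 < d & forall u v, u <= x -> x <= v -> x - d < u -> v < x + d ->
    f u - f v <= e * (v - u).
Proof.
move=> [dfx dfE] df0 e0.
have {dfE} : (h^-1 *: ((f \o shift x) (h *: 1) - f x) @[h --> 0^'] --> df)%classic.
  by rewrite -dfE; exact: dfx.
move=> /cvgrPdist_lt/(_ _ e0)[d/= d0 dP].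
have slope h : h != 0 -> `|h| < d -> - e < h^-1 * (f (h + x) - f x).
  move=> h0 hd; have := dP h; rewrite /ball_/= sub0r normrN => /(_ hd h0).
  rewrite [h *: 1]mulr1 /GRing.scale/=.
  by rewrite ltr_norml => /andP[_]; lra.
exists d => // u v ux xv du vd.
have up : f x - f v <= e * (v - x).
  have [->|xNv] := eqVneq x v; first by rewrite !subrr mulr0.
  have vx : 0 < v - x by rewrite subr_gt0 lt_neqAle xNv.
  have := slope (v - x); rewrite gt_eqF// gtr0_norm// ltrBlDl => /(_ isT vd).
  by rewrite subrK mulrC ltr_pdivlMr//; lra.
have lo : f u - f x <= e * (x - u).
  have [->|uNx] := eqVneq u x; first by rewrite !subrr mulr0.
  have xu : u - x < 0 by rewrite subr_lt0 lt_neqAle uNx.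
  have := slope (u - x); rewrite lt_eqF// ltr0_norm// opprB ltrBlDl.
  rewrite -ltrBlDr => /(_ isT du).
  by rewrite subrK mulrC ltr_ndivlMr//; lra.
lra.
Qed.

(** Cover the exceptional null set by an open set [U] of small measure and chain
local estimates by [interval_induction].  Near a point with nonnegative
derivative the decrease of [f] is at most [e] times the length; near an
exceptional point the interval lies in [U] and is recorded in a list.  The
recorded intervals are disjoint and of small total length, so absolute
continuity makes their contribution small. *)
Lemma abs_continuous_ge0_nondecreasing (R : realType) (f : R -> R) (a b : R) :
  a <= b -> abs_continuous_on a b f ->
  {ae lebesgue_measure, forall t, a < t < b ->
     exists2 df, is_derive t 1 f df & 0 <= df} ->
  f a <= f b.
Proof.
move=> ab acf [N [mN N0 NP]].
suff H e : 0 < e -> f a - f b <= e * (b - a) + e.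
  apply/ler_addgt0Pr => e e0; rewrite -lerBlDl.
  (* This choice makes e' (b - a) + e' equal to e. *)
  have e'0 : 0 < e / (b - a + 1) by rewrite divr_gt0//; lra.
  apply: le_trans (H _ e'0) _.
  rewrite -[X in _ + X]mulr1 -mulrDr divfK//; lra.
move=> e0; have [d d0 dP] := acf e e0.
(* The endpoints, where no derivative is assumed, join the null set. *)
pose N' := (N `|` [set a; b])%classic.
have mN' : measurable N' by apply: measurableU => //; apply: measurableU.
have N'0 : lebesgue_measure N' = 0%E.
  have s0 (x : R) : lebesgue_measure [set x] = 0%E by exact: lebesgue_measure_set1.
  have ab0 : lebesgue_measure [set a; b]%classic = 0%E.
    by rewrite [LHS]measureU0//; exact: s0.
  by rewrite [LHS]measureU0//; exact: measurableU.
have N'oo : (lebesgue_measure N' < +oo)%E by rewrite N'0.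
have [U [oU N'U Ud]] := lebesgue_regularity_outer mN' N'oo d0.
have mU : measurable U by exact: open_measurable.
have {}Ud : (lebesgue_measure U < d%:E)%E.
  apply: le_lt_trans Ud; rewrite -{1}(setDUK N'U).
  apply: le_trans; first by apply: measureU2 => //; exact: measurableD.
  by rewrite [X in (X + _)%E]N'0 add0e.
(* The list s records the subintervals of [u, v] spent inside U. *)
pose P (u v : R) := exists s : seq (R * R),
  [/\ forall p, p \in s -> [/\ u <= p.1, p.1 <= p.2, p.2 <= v
     & `]p.1, p.2[ `<=` U]%classic,
     pairwise (fun p q : R * R => p.2 <= q.1) s
   & f u - f v <= e * (v - u) + \sum_(p <- s) `|f p.2 - f p.1|].
have [s [sU sS sP]] : P a b.
  apply: interval_induction => //.
    move=> u v w au uv vw wb [s1 [U1 S1 P1]] [s2 [U2 S2 P2]].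
    exists (s1 ++ s2); split.
    - move=> p; rewrite mem_cat => /orP[/U1|/U2] [? ? ? ?]; split => //.
        exact: le_trans vw.
      exact: le_trans uv _.
    - rewrite pairwise_cat S1 S2 !andbT; apply/allrelP => p q /U1[_ _ pv _] /U2[vq _ _ _].
      exact: le_trans pv vq.
    - by rewrite big_cat/=; lra.
  move=> x ax xb; have [xN'|xN'] := pselect (N' x).
    have /nbhs_ballP[r/= r0 rU] : nbhs x U by apply: open_nbhs_nbhs; split => //; exact: N'U.
    exists r => // u v au ux xv vb ru vr; exists [:: (u, v)]; split.
    - move=> p; rewrite inE => /eqP ->/=; split => //; first exact: le_trans ux xv.
      move=> z/=; rewrite in_itv/= => /andP[uz zv]; apply: rU.
      by rewrite /ball/= ltr_norml; apply/andP; split; lra.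
    - by [].
    - rewrite big_seq1/= distrC -[leLHS]add0r lerD ?ler_norm// mulr_ge0 ?(ltW e0)//.
      by rewrite subr_ge0 (le_trans ux).
  have [df fdf df0] : exists2 df, is_derive x 1 f df & 0 <= df.
    have xNN : ~ N x by move=> Nx; apply: xN'; left.
    have xa : x != a by apply/eqP => E; apply: xN'; right; left.
    have xb' : x != b by apply/eqP => E; apply: xN'; right; right.
    apply: contrapT => H; apply: xNN; apply: NP => /= /(_ _)/H; apply.
    by rewrite !lt_neqAle eq_sym xa xb' ax.
  have [r r0 rP] := derive_ge0_local fdf df0 e0.
  by exists r => // u v au ux xv vb ru vr; exists [::]; split => //; rewrite big_nil addr0; exact: rP.
apply: le_trans sP _; rewrite lerD2l ltW//.
exact: (abs_continuous_sorted_seq dP mU Ud).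
Qed.

(** * Differential inequalities for absolutely continuous functions *)

Lemma ae_sub (R : realType) (P Q : R -> Prop) :
  (forall t, P t -> Q t) -> {ae lebesgue_measure, forall t, P t} ->
  {ae lebesgue_measure, forall t, Q t}.
Proof.
move=> PQ [N [mN N0 NP]]; exists N; split => //.
by move=> t nQ; apply: NP => /PQ.
Qed.

Lemma ae_except_point (R : realType) (x : R) (P Q : R -> Prop) :
  (forall t, t != x -> P t -> Q t) ->
  {ae lebesgue_measure, forall t, P t} -> {ae lebesgue_measure, forall t, Q t}.
Proof.
move=> PQ [N [mN N0 NP]]; exists (N `|` [set x])%classic; split.
- exact: measurableU.
- by rewrite [LHS]measureU0//; exact: lebesgue_measure_set1.
- move=> t nQ; have [->|tx] := eqVneq t x; first by right.
  by left; apply: NP => /(PQ _ tx).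
Qed.

Lemma abs_continuous_on_subitv (R : realType) (V : normedModType R)
    (a b a' b' : R) (f : R -> V) :
  a <= a' -> b' <= b -> abs_continuous_on a b f -> abs_continuous_on a' b' f.
Proof.
move=> aa bb acf e e0; have [d d0 dP] := acf e e0; exists d => // n l r lr.
by apply: dP => i; have [al lri rb] := lr i; split => //; [exact: le_trans al|exact: le_trans bb].
Qed.

Lemma eq_abs_continuous_on (R : realType) (V : normedModType R) (a b : R)
    (f g : R -> V) :
  (forall t, a <= t <= b -> f t = g t) ->
  abs_continuous_on a b f -> abs_continuous_on a b g.
Proof.
move=> fg acf e e0; have [d d0 dP] := acf e e0; exists d => // n l r lr tlr sd.
apply: le_lt_trans (dP n l r lr tlr sd); apply: ler_sum => i _.
have [al lri rb] := lr i; rewrite (fg (r i)) ?rb ?(le_trans al)//.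
by rewrite (fg (l i)) ?al ?(le_trans lri).
Qed.

Lemma lipschitz_abs_continuous (R : realType) (V : normedModType R)
    (a b L : R) (f : R -> V) :
  0 <= L ->
  (forall l r, a <= l -> l <= r -> r <= b -> `|f r - f l| <= L * (r - l)) ->
  abs_continuous_on a b f.
Proof.
move=> L0 fL e e0; have L1 : 0 < L + 1 by lra.
exists (e / (L + 1)); first by rewrite divr_gt0.
move=> n l r lr _; rewrite ltr_pdivlMr// mulrC => sd.
apply: le_lt_trans sd; rewrite mulr_sumr; apply: ler_sum => i _.
have [al lri rb] := lr i; apply: le_trans (fL _ _ al lri rb) _.
by rewrite ler_wpM2r ?subr_ge0// lerDl.
Qed.

Lemma derive_bounded_lipschitz (R : realType) (f df : R -> R) (a b L : R) :
  (forall x, a <= x <= b -> is_derive x 1 f (df x)) ->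
  (forall x, a <= x <= b -> `|df x| <= L) ->
  forall l r, a <= l -> l <= r -> r <= b -> `|f r - f l| <= L * (r - l).
Proof.
move=> fdf dfL l r al lr rb.
have inab x : x \in `[l, r] -> a <= x <= b.
  by rewrite in_itv/= => /andP[lx xr]; rewrite (le_trans al)// (le_trans xr).
have fc : {within `[l, r], continuous f}%classic.
  apply: derivable_within_continuous => x /inab/fdf dfx; exact: ex_derive.
have fd x : x \in `]l, r[ -> is_derive x 1 f (df x).
  by move=> xlr; apply: fdf; apply: inab; apply: subset_itv_oo_cc xlr.
have [c clr ->] := MVT_segment lr fd fc.
by rewrite normrM (ger0_norm (_ : 0 <= r - l)) ?subr_ge0// ler_wpM2r ?subr_ge0// dfL// inab.
Qed.

Lemma abs_continuous_onD (R : realType) (V : normedModType R) (a b : R)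
    (f g : R -> V) :
  abs_continuous_on a b f -> abs_continuous_on a b g ->
  abs_continuous_on a b (fun t => f t + g t).
Proof.
move=> acf acg e e0; have e20 : 0 < e / 2 by rewrite divr_gt0.
have [d d0 dP] := acf _ e20; have [d' d'0 d'P] := acg _ e20.
exists (Num.min d d'); first by rewrite lt_min d0.
move=> n l r lr tlr; rewrite lt_min => /andP[sd sd'].
have := ltrD (dP n l r lr tlr sd) (d'P n l r lr tlr sd'); rewrite -splitr.
apply: le_lt_trans; rewrite -big_split/=; apply: ler_sum => i _.
by rewrite opprD addrACA ler_normD.
Qed.

Lemma abs_continuous_uniform (R : realType) (V : normedModType R) (a b e : R)
    (f : R -> V) : abs_continuous_on a b f -> 0 < e ->
  exists2 d, 0 < d & forall l r, a <= l -> l <= r -> r <= b -> r - l < d ->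
    `|f r - f l| < e.
Proof.
move=> acf e0; have [d d0 dP] := acf e e0; exists d => // l r al lr rb rld.
have := dP 1%N (fun=> l) (fun=> r); rewrite !big_ord1; apply => //.
by apply/trivIsetP => i j _ _; rewrite !ord1 eqxx.
Qed.

(** Local boundedness is enough, by [interval_induction]. *)
Lemma abs_continuous_bounded (R : realType) (V : normedModType R) (a b : R)
    (f : R -> V) : a <= b -> abs_continuous_on a b f ->
  exists M, forall t, a <= t <= b -> `|f t| <= M.
Proof.
move=> ab acf.
pose P u v := exists M, forall t, u <= t <= v -> `|f t| <= M.
apply: (@interval_induction R P a b ab).
  move=> u v w _ _ _ _ [M HM] [M' HM']; exists (Num.max M M') => t /andP[ut tw].
  rewrite le_max; have [tv|vt] := leP t v; first by rewrite HM// ut.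
  by rewrite HM' ?orbT// (ltW vt).
have [d d0 dP] := abs_continuous_uniform acf ltr01.
move=> x ax xb; exists d => // u v au ux xv vb ud vd; exists (`|f x| + 1).
move=> t /andP[ut tv]; rewrite -[f t](subrK (f x)).
rewrite (le_trans (ler_normD _ _))// [leRHS]addrC lerD2r.
have [tx|xt] := leP t x.
  by rewrite distrC ltW// dP//; [exact: le_trans ut|lra].
by rewrite ltW// dP//; [exact: ltW|exact: le_trans vb|lra].
Qed.

Lemma abs_continuous_onM (R : realType) (a b : R) (f g : R -> R) : a <= b ->
  abs_continuous_on a b f -> abs_continuous_on a b g ->
  abs_continuous_on a b (fun t => f t * g t).
Proof.
move=> ab acf acg.
have [M fM] := abs_continuous_bounded ab acf.
have [N gN] := abs_continuous_bounded ab acg.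
have aab : a <= a <= b by rewrite lexx.
have M0 : 0 < M + 1 by have := fM _ aab; have := normr_ge0 (f a); lra.
have N0 : 0 < N + 1 by have := gN _ aab; have := normr_ge0 (g a); lra.
move=> e e0; have e20 : 0 < e / 2 by rewrite divr_gt0.
have [d d0 dP] := acf _ (divr_gt0 e20 N0).
have [d' d'0 d'P] := acg _ (divr_gt0 e20 M0).
exists (Num.min d d'); first by rewrite lt_min d0.
move=> n l r lr tlr; rewrite lt_min => /andP[sd sd'].
have := dP n l r lr tlr sd; rewrite ltr_pdivlMr// => Hf.
have := d'P n l r lr tlr sd'; rewrite ltr_pdivlMr// => Hg.
have := ltrD Hf Hg; rewrite -splitr; apply: le_lt_trans.
rewrite !mulr_suml -big_split/=; apply: ler_sum => i _.
have [al lri rb] := lr i.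
have -> : f (r i) * g (r i) - f (l i) * g (l i) =
    (f (r i) - f (l i)) * g (r i) + (g (r i) - g (l i)) * f (l i) by ring.
rewrite (le_trans (ler_normD _ _))// !normrM; apply: lerD; apply: ler_wpM2l => //.
  by have := gN (r i); rewrite rb (le_trans al)//= => /(_ isT); lra.
by have := fM (l i); rewrite al (le_trans lri)//= => /(_ isT); lra.
Qed.

Lemma is_derive_expRM (R : realType) (c x : R) :
  is_derive x 1 (fun t => expR (c * t)) (c * expR (c * x)).
Proof.
have h : is_derive x 1 (fun t : R => c * t) c.
  by apply: is_derive_eq; rewrite [c *: _]mulr1.
by rewrite mulrC; exact: (is_derive1_comp (is_derive_expR (c * x)) h).
Qed.

Lemma abs_continuous_expRM (R : realType) (a b c : R) :
  abs_continuous_on a b (fun t => expR (c * t)).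
Proof.
pose L := `|c| * (expR (c * a) + expR (c * b)).
have L0 : 0 <= L by rewrite mulr_ge0// addr_ge0 ?expR_ge0.
apply: (lipschitz_abs_continuous L0).
apply: (derive_bounded_lipschitz (fun x _ => is_derive_expRM c x)) => x /andP[ax xb].
rewrite normrM ler_wpM2l// ger0_norm ?expR_ge0//.
have [c0|/ltW c0] := leP 0 c.
  by rewrite ler_wpDl ?expR_ge0// ler_expR ler_wpM2l.
by rewrite ler_wpDr ?expR_ge0// ler_expR ler_wnM2l.
Qed.

(** Gronwall-type comparison with the solution
- kap e^(- mu t) of f' = lam f + kap (lam + mu) e^(- mu t): the difference
multiplied by the integrating factor e^(- lam t) has a nonnegative derivative.
Writing the forcing term with the factor (lam + mu) avoids a division, and
kap = 0 gives the homogeneous case. *)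
Lemma abs_continuous_expR_comparison (R : realType) (f : R -> R)
    (a b lam mu kap : R) :
  a <= b -> abs_continuous_on a b f ->
  {ae lebesgue_measure, forall t, a < t < b ->
     exists2 df, is_derive t 1 f df &
       lam * f t + kap * (lam + mu) * expR (- mu * t) <= df} ->
  f a * expR (- lam * a) + kap * expR (- (lam + mu) * a) <=
  f b * expR (- lam * b) + kap * expR (- (lam + mu) * b).
Proof.
move=> ab acf fdf.
pose g t := f t * expR (- lam * t) + kap * expR (- (lam + mu) * t).
apply: (@abs_continuous_ge0_nondecreasing _ g) => //.
  apply: abs_continuous_onD.
    by apply: abs_continuous_onM => //; exact: abs_continuous_expRM.
  apply: abs_continuous_onM => //; last exact: abs_continuous_expRM.
  by apply: (@lipschitz_abs_continuous _ _ _ _ 0) => // l r *; rewrite subrr normr0 mul0r.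
apply: ae_sub fdf => t H /H[df dft dfge].
pose E := expR (- lam * t).
have dE := is_derive_expRM (- lam) t.
have dK := is_derive_expRM (- (lam + mu)) t.
exists ((df - lam * f t - kap * (lam + mu) * expR (- mu * t)) * E).
  apply: is_derive_eq.
  rewrite /E /GRing.scale/=.
  have -> : expR (- (lam + mu) * t) = expR (- lam * t) * expR (- mu * t).
    by rewrite -expRD; congr expR; ring.
  ring.
by rewrite mulr_ge0 ?expR_ge0// -addrA -opprD subr_ge0.
Qed.

(** * Growth of global solutions *)

Lemma abs_continuous_entry (R : realType) (m n : nat) (a b : R)
    (M : R -> 'M[R]_(m.+1, n.+1)) i j :
  abs_continuous_on a b M -> abs_continuous_on a b (fun t => M t i j).
Proof.
move=> acM e e0; have [d d0 dP] := acM e e0; exists d => // k l r lr tlr sd.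
apply: le_lt_trans (dP k l r lr tlr sd); apply: ler_sum => p _.
rewrite [leRHS]/Num.Def.normr/= mx_normrE.
by apply: le_trans; last exact: (le_bigmax _ _ (i, j)); rewrite !mxE.
Qed.

Lemma is_derive_entry (R : realType) (m n : nat)
    (M : R -> 'M[R]_(m.+1, n.+1)) (t : R) D i j :
  is_derive t 1 M D -> is_derive t 1 (fun t => M t i j) (D i j).
Proof.
move=> [dM <-]; rewrite derive_mx// mxE; apply: DeriveDef => //.
by move/derivable_mxP : dM.
Qed.

Section Growth.
Variables (R : realType) (alpha beta gamma delta : R).
Hypotheses (alpha_gt0 : 0 < alpha) (gamma_gt0 : 0 < gamma)
  (delta_gt0 : 0 < delta) (gamma_large : 2 * alpha < gamma).

Let A := coef_mx alpha beta gamma delta.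
Let F := perturbed_rhs alpha beta gamma delta.

Lemma coef_mx_unit t : 0 <= t < 1 -> A t = mx22 (- alpha) delta 0 (- beta).
Proof. by move=> t01; rewrite /A /coef_mx asboolT//; left. Qed.

Lemma coef_mx_expanding k t : 2 ^+ (2 * k)%N <= t < 2 ^+ (2 * k + 1)%N ->
  A t = mx22 (- alpha) delta 0 gamma.
Proof.
move=> /andP[kt tk]; rewrite /A /coef_mx asboolF; last first.
  case=> [/andP[_ t1]|[j /andP[jt tj]]].
    have : 2 ^+ (2 * k)%N < 1 :> R by exact: le_lt_trans kt t1.
    by rewrite ltNge exprn_ege1// ler1n.
  have := le_lt_trans jt tk; have := le_lt_trans kt tj.
  by rewrite !ltr_eXn2l ?ltr1n//; lia.
by rewrite asboolT//; exists k; rewrite kt.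
Qed.

(** The rate [c] of [y] is left open: y' >= c y keeps [y] nonnegative for any
constant c. *)
Lemma coef_mx_dyadic m : exists c, forall t, 2 ^+ m <= t < 2 ^+ m.+1 ->
  A t = mx22 (- alpha) delta 0 c.
Proof.
have [mo|me] := boolP (odd m).
  exists (- beta) => t mt; rewrite /A /coef_mx asboolT//; right; exists m./2.
  have -> : (2 * m./2 + 1)%N = m by lia.
  by have -> : (2 * m./2 + 2)%N = m.+1 by lia.
exists gamma => t mt; apply: (@coef_mx_expanding m./2).
have -> : (2 * m./2 + 1)%N = m.+1 by lia.
by have -> : (2 * m./2)%N = m by lia.
Qed.

Lemma perturbed_rhsE c t v : A t = mx22 (- alpha) delta 0 c ->
  F t v 0 0 = - alpha * v 0 0 + delta * v 1 0 /\
  F t v 1 0 = c * v 1 0 + v 0 0 ^+ 2.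
Proof.
rewrite /F /perturbed_rhs -/A => ->.
rewrite !mxE !big_ord_recl !big_ord0 !mxE/= !addr0 mul0r add0r.
by have -> : lift ord0 ord0 = 1 :> 'I_2 by apply: val_inj.
Qed.

Variables (z : R -> 'cV[R]_2) (x0 : R).
Hypotheses (sol : solution_on F +oo%E z) (x0_gt0 : 0 < x0)
  (z0x : z 0 0 0 = x0) (z0y : z 0 1 0 = 0).

Let x t := z t 0 0.
Let y t := z t 1 0.

Let lower t := 0 <= y t /\ x0 * expR (- alpha * t) <= x t.


Lemma solution_entries_abs_continuous s t : 0 <= s -> s <= t ->
  abs_continuous_on s t x /\ abs_continuous_on s t y.
Proof.
move=> s0 st; have [_ acz _] := sol.
have /acz acz0 : time_interval +oo%E t by split; [exact: le_trans st|rewrite ltry].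
have acz1 := abs_continuous_on_subitv s0 (lexx t) acz0.
by split; exact: abs_continuous_entry.
Qed.

Lemma solution_entries_derive s t c : 0 <= s ->
  (forall u, s <= u < t -> A u = mx22 (- alpha) delta 0 c) ->
  {ae lebesgue_measure, forall u : R, s < u < t ->
    is_derive u 1 x (- alpha * x u + delta * y u) /\
    is_derive u 1 y (c * y u + x u ^+ 2)}.
Proof.
move=> s0 Ac; have [_ _] := sol; apply: ae_sub => u Hu /andP[su ut].
have /Hu du : time_interval +oo%E u.
  by split; [exact: le_trans (ltW su)|rewrite ltry].
have [|<- <-] := @perturbed_rhsE c u (z u); first by rewrite Ac// (ltW su).
by split; exact: is_derive_entry.
Qed.

(** First [y], by y' >= c y; then [x], whose inequality x' >= - alpha x uses
the sign of [y] just obtained. *)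
Lemma lower_segment s s' c : 0 <= s ->
  (forall t, s <= t < s' -> A t = mx22 (- alpha) delta 0 c) ->
  lower s -> forall t, s <= t <= s' -> lower t.
Proof.
move=> s0 Ac [ys xs].
have y0 t : s <= t <= s' -> 0 <= y t.
  move=> /andP[st ts'].
  have [_ acy] := solution_entries_abs_continuous s0 st.
  have := @abs_continuous_expR_comparison _ y s t c 0 0 st acy.
  rewrite !mul0r !addr0 => H.
  rewrite -(pmulr_lge0 _ (expR_gt0 (- c * t))); apply: le_trans (H _).
    by rewrite mulr_ge0 ?expR_ge0.
  apply: ae_sub (solution_entries_derive s0 Ac) => u Hu /andP[su ut].
  have [|_ dy] := Hu; first by rewrite su (lt_le_trans ut).
  by eexists; first exact: dy; rewrite !mul0r addr0 lerDl sqr_ge0.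
move=> t stt; split; first exact: y0.
case/andP: stt => st ts'.
have [acx _] := solution_entries_abs_continuous s0 st.
have := @abs_continuous_expR_comparison _ x s t (- alpha) 0 0 st acx.
rewrite !mul0r !addr0 opprK => H.
rewrite mulNr expRN ler_pdivrMr ?expR_gt0//; apply: le_trans (H _).
  by rewrite -ler_pdivrMr ?expR_gt0// -expRN -mulNr.
apply: ae_sub (solution_entries_derive s0 Ac) => u Hu /andP[su ut].
have us' : u < s' by exact: lt_le_trans ts'.
have [|dx _] := Hu; first by rewrite su us'.
eexists; first exact: dx; rewrite !mul0r addr0 lerDl mulr_ge0 ?(ltW delta_gt0)// y0//.
by rewrite (ltW su) ltW.
Qed.

Lemma lower_dyadic m t : 0 <= t <= 2 ^+ m -> lower t.
Proof.
elim: m t => [|m IH] t.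
  apply: (@lower_segment _ _ (- beta)) => //; first exact: coef_mx_unit.
  by rewrite /lower /x /y z0x z0y mulr0 expR0 mulr1.
move=> /andP[t0 tm]; have [tm'|mt] := leP t (2 ^+ m).
  by apply: IH; rewrite t0.
have [c cP] := coef_mx_dyadic m.
have m0 : 0 <= 2 ^+ m :> R by exact: exprn_ge0.
apply: (lower_segment m0 cP); last by rewrite (ltW mt).
by apply: IH; rewrite m0 lexx.
Qed.

(** On [T, 2T] the lower bound on [x] forces [y] at the rate
x0^2 e^(- 2 alpha t), to be compared with the decay rate 2 alpha < gamma. *)
Lemma solution_unbounded M : exists2 t, 0 <= t & M < y t.
Proof.
pose kap := x0 ^+ 2 / (gamma + 2 * alpha).
have ga0 : 0 < gamma + 2 * alpha by rewrite addr_gt0// mulr_gt0.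
have kap0 : 0 < kap by rewrite divr_gt0// exprn_gt0.
have gam0 : 0 < gamma - 2 * alpha by rewrite subr_gt0.
have kg0 : 0 < kap * (gamma - 2 * alpha) by rewrite mulr_gt0.
(* T = 4^k is at least k, so this k makes kap (gamma - 2 alpha) T exceed M. *)
pose k := (Num.truncn (`|M| / (kap * (gamma - 2 * alpha)))).+1.
have kM : M < kap * (gamma - 2 * alpha) * k%:R.
  rewrite (le_lt_trans (ler_norm M))// mulrC -ltr_pdivrMr//.
  exact: truncnS_gt.
pose T : R := 2 ^+ (2 * k)%N; have T0 : 0 <= T by exact: exprn_ge0.
have kT : k%:R <= T.
  rewrite /T -natrX ler_nat; apply: leq_trans (ltnW (ltn_expl k (ltnSn 1))) _.
  by rewrite leq_exp2l// leq_pmull.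
have T2 : 2 ^+ (2 * k + 1)%N = 2 * T by rewrite addn1 exprS.
have TT2 : T <= 2 * T by rewrite ler_peMl// ler1n.
exists (2 * T); first by rewrite mulr_ge0.
have [_ acy] := solution_entries_abs_continuous T0 TT2.
have Agamma t : T <= t < 2 * T -> A t = mx22 (- alpha) delta 0 gamma.
  by rewrite -T2; exact: coef_mx_expanding.
have := @abs_continuous_expR_comparison _ y T (2 * T) gamma (2 * alpha) kap TT2 acy.
have lowT t : T <= t <= 2 * T -> lower t.
  move=> /andP[Tt tT]; apply: (@lower_dyadic (2 * k + 1)).
  by rewrite T2 tT (le_trans T0).
have /[swap]/[apply] : {ae lebesgue_measure, forall t, T < t < 2 * T ->
    exists2 df, is_derive t 1 y df & gamma * y t +
      kap * (gamma + 2 * alpha) * expR (- (2 * alpha) * t) <= df}.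
  apply: ae_sub (solution_entries_derive T0 Agamma) => t Ht tT.
  have [_ dy] := Ht tT; eexists; first exact: dy.
  have [|_ xt] := lowT t; first by case/andP: tT => /ltW -> /ltW ->.
  rewrite lerD2l /kap divfK ?gt_eqF//.
  have -> : expR (- (2 * alpha) * t) = expR (- alpha * t) ^+ 2.
    by rewrite expr2 -expRD; congr expR; ring.
  rewrite -exprMn lerXn2r// nnegrE; first by rewrite mulr_ge0 ?expR_ge0// ltW.
  by apply: le_trans xt; rewrite mulr_ge0 ?expR_ge0// ltW.
move=> H.
have [yT _] : lower T by apply: lowT; rewrite lexx.
have {}H : kap * expR (- (gamma + 2 * alpha) * T) <=
   y (2 * T) * expR (- gamma * (2 * T)) + kap * expR (- (gamma + 2 * alpha) * (2 * T)).
  by apply: le_trans H; rewrite lerDr mulr_ge0 ?expR_ge0.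
have {H} : kap * expR ((gamma - 2 * alpha) * T) <= y (2 * T) + kap * expR (- 4 * alpha * T).
  have := ler_wpM2r (expR_ge0 (2 * gamma * T)) H.
  rewrite [leRHS]mulrDl -![_ * _ * expR (2 * gamma * T)]mulrA -!expRD.
  have -> : - (gamma + 2 * alpha) * T + 2 * gamma * T = (gamma - 2 * alpha) * T by ring.
  have -> : - gamma * (2 * T) + 2 * gamma * T = 0 by ring.
  have -> : - (gamma + 2 * alpha) * (2 * T) + 2 * gamma * T = - 4 * alpha * T by ring.
  by rewrite expR0 mulr1.
(* e^u >= 1 + u, and the two constant terms kap cancel. *)
have e1 : expR (- 4 * alpha * T) <= 1.
  by rewrite -expR0 ler_expR !mulNr oppr_le0 !mulr_ge0// ltW.
have := expR_ge1Dx ((gamma - 2 * alpha) * T).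
move/(ler_wpM2l (ltW kap0)) => h1 h2.
have h3 := ler_wpM2l (ltW kap0) e1.
have h4 := ler_wpM2l (ltW kg0) kT.
apply: lt_le_trans kM _; lra.
Qed.

End Growth.

(** * Power series with geometrically bounded coefficients *)

Section PowerSeries.
Variable R : realType.
Implicit Types (c : nat -> R) (t : R).

Lemma is_cvg_pseries_geometric c (C L t : R) :
  (forall n, `|c n| <= C * L ^+ n) -> 0 <= L -> L * `|t| < 1 ->
  cvgn (pseries c t).
Proof.
move=> cL L0 Lt.
have C0 : 0 <= C by have := cL 0%N; rewrite expr0 mulr1; apply: le_trans.
have Lt0 : 0 <= L * `|t| by rewrite mulr_ge0.
apply: normed_cvg; rewrite /=.
apply: (@series_le_cvg _ _ (geometric C (L * `|t|))) => [n|n|n|] //=.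
- by rewrite mulr_ge0// exprn_ge0.
- by rewrite normrM normrX exprMn mulrA ler_wpM2r// exprn_ge0.
- by apply: is_cvg_geometric_series; rewrite ger0_norm.
Qed.

Lemma sum_half_le2 n : \sum_(0 <= i < n) (2^-1 : R) ^+ i <= 2.
Proof.
suff -> : \sum_(0 <= i < n) (2^-1 : R) ^+ i = 2 - 2 * 2^-1 ^+ n.
  by rewrite gerBl mulr_ge0// exprn_ge0.
elim: n => [|n IH]; first by rewrite big_nil expr0 mulr1 subrr.
by rewrite big_nat_recr//= IH exprS mulrA mulfV// mul1r; ring.
Qed.

Lemma pseries_partial_le2 c (K t : R) n :
  (forall n, `|c n| <= K ^+ n) -> 0 <= K -> K * `|t| <= 2^-1 ->
  `|pseries c t n| <= 2.
Proof.
move=> cK K0 Kt; apply: le_trans (ler_norm_sum _ _ _) _.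
apply: le_trans (sum_half_le2 n); apply: ler_sum => i _.
rewrite normrM normrX; apply: (@le_trans _ _ ((K * `|t|) ^+ i)).
  by rewrite exprMn ler_wpM2r// exprn_ge0.
by apply: lerXn2r => //; rewrite nnegrE ?mulr_ge0// invr_ge0.
Qed.

Lemma lim_pseries_le2 c (K t : R) :
  (forall n, `|c n| <= K ^+ n) -> 0 <= K -> K * `|t| <= 2^-1 ->
  `|limn (pseries c t)| <= 2.
Proof.
move=> cK K0 Kt; have H n := pseries_partial_le2 n cK K0 Kt.
have cvg_c : cvgn (pseries c t).
  apply: (@is_cvg_pseries_geometric _ 1 K) => //.
    by move=> n; rewrite mul1r.
  by apply: le_lt_trans Kt _; rewrite invf_lt1// ltr1n.
rewrite ler_norml; apply/andP; split.
  by apply: limr_ge => //; apply: nearW => n; have := H n; rewrite ler_norml => /andP[].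
by apply: limr_le => //; apply: nearW => n; have := H n; rewrite ler_norml => /andP[].
Qed.

Lemma natr_leX2 n : n.+1%:R <= 2 ^+ n :> R.
Proof. by rewrite -natrX ler_nat; exact: ltn_expl. Qed.

(** Termwise differentiation asks for the convergence at one point of the series
and of its first two derived series.  The factors n.+1 and n.+2 are absorbed by
powers of 2, so the coefficients are dominated by powers of 4 K, which the
radius 1 / (8 K) compensates. *)
Lemma is_derive_pseries_geometric c (K t : R) :
  (forall n, `|c n| <= K ^+ n) -> 0 < K -> `|t| < (8 * K)^-1 ->
  is_derive t 1 (fun u => limn (pseries c u)) (limn (pseries (pseries_diffs c) t)).
Proof.
move=> cK K0 tK; have rho0 : 0 < (8 * K)^-1 by rewrite invr_gt0 mulr_gt0.
have K4 : 4 * K * `|(8 * K)^-1| < 1.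
  by rewrite gtr0_norm// ltr_pdivrMr ?mulr_gt0// mul1r ltr_pM2r// ltr_nat.
have K2 : 2 * K * `|(8 * K)^-1| < 1.
  by rewrite gtr0_norm// ltr_pdivrMr ?mulr_gt0// mul1r ltr_pM2r// ltr_nat.
have K1 : K * `|(8 * K)^-1| < 1.
  by rewrite gtr0_norm// ltr_pdivrMr ?mulr_gt0// mul1r ltr_pMl// ltr1n.
apply: (@pseries_snd_diffs _ _ (8 * K)^-1).
- by apply: (@is_cvg_pseries_geometric _ 1 K) => //; [move=> n; rewrite mul1r|exact: ltW].
- apply: (@is_cvg_pseries_geometric _ K (2 * K)) => //; last by rewrite mulr_ge0// ltW.
  move=> n; rewrite /pseries_diffs normrM normr_nat exprMn mulrCA -exprS.
  by rewrite ler_pM// natr_leX2.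
- apply: (@is_cvg_pseries_geometric _ (2 * K ^+ 2) (4 * K)) => //; last by rewrite mulr_ge0// ltW.
  move=> n; rewrite /pseries_diffs !normrM !normr_nat.
  have -> : 2 * K ^+ 2 * (4 * K) ^+ n = 2 ^+ n * (2 ^+ n.+1 * K ^+ n.+2).
    have -> : 4 = 2 * 2 :> R by rewrite -natrM.
    by rewrite !exprMn !exprS; ring.
  apply: ler_pM; rewrite ?mulr_ge0// ?natr_leX2//.
  by apply: ler_pM; rewrite ?natr_leX2.
- by rewrite [ltRHS]gtr0_norm.
Qed.

Definition cauchy_square c n := \sum_(0 <= i < n.+1) c i * c (n - i)%N.

Lemma sum_triangle (G : nat -> nat -> R) N :
  \sum_(0 <= n < N) \sum_(0 <= i < n.+1) G i (n - i)%N =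
  \sum_(0 <= i < N) \sum_(0 <= j < N - i) G i j.
Proof.
elim: N => [|N IH]; first by rewrite !big_nil.
rewrite [LHS]big_nat_recr//= IH.
transitivity (\sum_(0 <= i < N.+1) (\sum_(0 <= j < N - i) G i j + G i (N - i)%N)).
  by rewrite big_split/=; congr (_ + _); rewrite big_nat_recr//= subnn [X in _ + X]big_nil addr0.
by apply: eq_big_nat => i iN; rewrite subSn// big_nat_recr.
Qed.

(** The error collects the products of indices i, j < N with i + j >= N.  Each is
at most 4^-(i + j) = 2^-(i + j) 2^-(i + j) <= 2^-N 2^-i 2^-j, and the sum of
the 2^-i 2^-j is at most 4. *)
Lemma cauchy_square_error c (K t : R) N :
  (forall n, `|c n| <= K ^+ n) -> 0 <= K -> K * `|t| <= 4^-1 ->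
  `|pseries c t N * pseries c t N - pseries (cauchy_square c) t N|
    <= 4 * 2^-1 ^+ N.
Proof.
move=> cK K0 Kt; pose g i := c i * t ^+ i.
have h0 i : 0 <= (2^-1 : R) ^+ i by rewrite exprn_ge0.
have gle i : `|g i| <= 2^-1 ^+ i * 2^-1 ^+ i.
  rewrite normrM normrX -exprMn -invfM -natrM.
  apply: (@le_trans _ _ ((K * `|t|) ^+ i)).
    by rewrite exprMn ler_wpM2r// exprn_ge0.
  by apply: lerXn2r => //; rewrite nnegrE ?mulr_ge0// invr_ge0.
have -> : pseries (cauchy_square c) t N =
    \sum_(0 <= i < N) \sum_(0 <= j < N - i) g i * g j.
  rewrite -sum_triangle /pseries /series/=; apply: eq_big_nat => n _.
  rewrite /cauchy_square mulr_suml; apply: eq_big_nat => i; rewrite ltnS => iN.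
  have -> : t ^+ n = t ^+ i * t ^+ (n - i) by rewrite -exprD subnKC.
  by rewrite /g mulrACA.
have -> : pseries c t N * pseries c t N - \sum_(0 <= i < N) \sum_(0 <= j < N - i) g i * g j
   = \sum_(0 <= i < N) \sum_(N - i <= j < N) g i * g j.
  apply/eqP; rewrite subr_eq -big_split/=; apply/eqP.
  rewrite {1}/pseries /series/= mulr_suml; apply: eq_big_nat => i iN.
  by rewrite mulr_sumr addrC -big_cat_nat//= leq_subr.
apply: (@le_trans _ _ (\sum_(0 <= i < N) \sum_(0 <= j < N)
    2^-1 ^+ N * (2^-1 ^+ i * 2^-1 ^+ j))).
  apply: le_trans (ler_norm_sum _ _ _) _; apply: ler_sum_nat => i iN.
  apply: le_trans (ler_norm_sum _ _ _) _.
  apply: (@le_trans _ _ (\sum_(N - i <= j < N) 2^-1 ^+ N * (2^-1 ^+ i * 2^-1 ^+ j))).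
    apply: ler_sum_nat => j /andP[ij jN].
    rewrite normrM; apply: le_trans (ler_pM _ _ (gle i) (gle j)) _ => //.
    rewrite mulrACA -exprD ler_wpM2r// ?mulr_ge0//.
    by apply: ler_wiXn2l; [rewrite invr_ge0|rewrite invf_le1// ler1n|lia].
  rewrite [leRHS](@big_cat_nat _ _ _ (N - i))//= ?leq_subr// lerDr.
  by apply: sumr_ge0 => j _; rewrite !mulr_ge0.
under eq_bigr do rewrite -mulr_sumr -mulr_sumr.
rewrite -mulr_sumr -mulr_suml mulrC ler_wpM2r//.
have -> : (4 : R) = 2 * 2 by rewrite -natrM.
by apply: ler_pM; rewrite ?sum_half_le2// sumr_ge0.
Qed.

Lemma cvg_cauchy_square c (K t : R) :
  (forall n, `|c n| <= K ^+ n) -> 0 <= K -> K * `|t| <= 4^-1 ->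
  (pseries (cauchy_square c) t @ \oo --> limn (pseries c t) ^+ 2)%classic.
Proof.
move=> cK K0 Kt.
have cvg_c : cvgn (pseries c t).
  apply: (@is_cvg_pseries_geometric _ 1 K) => //.
    by move=> n; rewrite mul1r.
  by apply: le_lt_trans Kt _; rewrite invf_lt1// ltr1n.
have cvg2 : (pseries c t \* pseries c t @ \oo --> limn (pseries c t) ^+ 2)%classic.
  by rewrite expr2; apply: cvgM.
apply: cvg_sub0 cvg2.
apply: (@norm_cvg0 _ R^o).
apply: (@squeeze_cvgr _ _ _ _ (cst 0) (geometric 4 2^-1)).
- apply: nearW => n; rewrite normr_ge0/= distrC.
  exact: cauchy_square_error Kt.
- exact: cvg_cst.
- by apply: cvg_geometric; rewrite ger0_norm// invf_lt1// ltr1n.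
Qed.

Lemma lim_pseries0 c : limn (pseries c 0) = c 0%N.
Proof.
apply: lim_near_cst => //; near=> n.
have n0 : (0 < n)%N by near: n; exact: nbhs_infty_gt.
rewrite /pseries /series/= big_ltn// expr0 mulr1 big_nat big1 ?addr0//.
by move=> i /andP[i0 _]; rewrite expr0n gtn_eqF// mulr0.
Unshelve. all: by end_near. Qed.

End PowerSeries.

(** * Local solution by Taylor series *)

Section LocalSolution.
Variables (R : realType) (alpha beta gamma delta x0 : R).
Hypotheses (alpha_gt0 : 0 < alpha) (beta_gt0 : 0 < beta)
  (delta_gt0 : 0 < delta) (x0_gt0 : 0 < x0) (x0_le1 : x0 <= 1).

(** The Taylor coefficients (a_n, b_n) of (x, y) obey a recursion on all
previous values, because of the square: [taylor_table n] lists those of index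
at most [n] and is only meaningful there. *)
Fixpoint taylor_table (n : nat) : nat -> R * R :=
  if n is m.+1 then fun k =>
    let T := taylor_table m in
    if (k <= m)%N then T k else
      ((- alpha * (T m).1 + delta * (T m).2) / m.+1%:R,
       (- beta * (T m).2 + cauchy_square (fun i => (T i).1) m) / m.+1%:R)
  else fun=> (x0, 0).

Let a n := (taylor_table n n).1.
Let b n := (taylor_table n n).2.

Lemma taylor_table_stable m k : (k <= m)%N -> taylor_table m k = taylor_table k k.
Proof.
elim: m => [|m IH]; first by rewrite leqn0 => /eqP ->.
by rewrite leq_eqVlt => /predU1P[->//|]; rewrite ltnS => km /=; rewrite km IH.
Qed.

Lemma pseries_diffs_a n : pseries_diffs a n = - alpha * a n + delta * b n.
Proof. by rewrite /pseries_diffs /a /b /= ltnn/= mulrC divfK// pnatr_eq0. Qed.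

Lemma pseries_diffs_b n : pseries_diffs b n = - beta * b n + cauchy_square a n.
Proof.
rewrite /pseries_diffs {1}/b /= ltnn/= mulrC divfK ?pnatr_eq0//; congr (_ + _).
apply: eq_big_nat => i; rewrite ltnS => iN.
by rewrite /a (taylor_table_stable iN) (taylor_table_stable (leq_subr i n)).
Qed.

Let K := alpha + beta + delta + 1.
Let K_ge1 : 1 <= K.
Proof. by rewrite lerDr !addr_ge0// ltW. Qed.
Let K_gt0 : 0 < K. Proof. exact: lt_le_trans K_ge1. Qed.

(** The n.+1 products in the Cauchy square of order n are each at most K^n, so
they are balanced by the division by n.+1 in the recursion; the constant
K = alpha + beta + delta + 1 takes care of the linear terms. *)
Lemma taylor_coef_bound n : `|a n| <= K ^+ n /\ `|b n| <= K ^+ n.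
Proof.
elim/ltn_ind: n => -[_|n IH].
  by rewrite /a /b/= expr0 normr0 gtr0_norm.
have [an bn] := IH n (ltnSn n).
have Kn0 : 0 <= K ^+ n by rewrite exprn_ge0// ltW.
have n1 : 1 <= n.+1%:R :> R by rewrite ler1n.
have n0 : 0 < n.+1%:R :> R by [].
have scale u : n.+1%:R * `|u| <= n.+1%:R * K ^+ n.+1 -> `|u| <= K ^+ n.+1.
  by rewrite ler_pM2l.
have normS c : n.+1%:R * `|c n.+1| = `|pseries_diffs c n|.
  by rewrite /pseries_diffs normrM normr_nat.
have H1 : alpha * `|a n| + delta * `|b n| <= (alpha + delta) * K ^+ n.
  by rewrite mulrDl lerD// ler_pM2l.
have H2 : beta * `|b n| + n.+1%:R * K ^+ n <= n.+1%:R * K ^+ n.+1.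
  apply: (@le_trans _ _ (n.+1%:R * (beta * K ^+ n) + n.+1%:R * K ^+ n)).
    rewrite lerD2r -[leLHS]mul1r; apply: ler_pM => //; first by rewrite mulr_ge0// ltW.
    by rewrite ler_pM2l.
  rewrite -mulrDr ler_pM2l// exprS -[X in _ + X]mul1r -mulrDl ler_wpM2r//.
  by rewrite /K lerD2r addrAC lerDr addr_ge0// ltW.
split; apply: scale; rewrite normS.
  rewrite pseries_diffs_a (le_trans (ler_normD _ _))// !normrM normrN.
  rewrite (gtr0_norm alpha_gt0) (gtr0_norm delta_gt0) (le_trans H1)//.
  apply: (@le_trans _ _ (1 * K ^+ n.+1)).
    rewrite mul1r exprS ler_wpM2r// /K -addrA addrACA lerDl.
    by rewrite addr_ge0// ltW.
  by rewrite ler_wpM2r// exprn_ge0// ltW.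
rewrite pseries_diffs_b (le_trans (ler_normD _ _))// normrM normrN.
rewrite (gtr0_norm beta_gt0) (le_trans _ H2)// lerD2l.
apply: le_trans (ler_norm_sum _ _ _) _.
rewrite mulr_natl -[X in _ *+ X](subn0 n.+1) -sumr_const_nat.
apply: ler_sum_nat => i /=; rewrite ltnS => iN.
rewrite normrM -{2}(subnKC iN) exprD; apply: ler_pM => //.
  by have [] := IH i iN.
by have [] := IH (n - i)%N (leq_ltn_trans (leq_subr i n) (ltnSn n)).
Qed.

Let rho := (8 * K)^-1.
Let X t := limn (pseries a t).
Let Y t := limn (pseries b t).
Let a_bound n : `|a n| <= K ^+ n. Proof. by have [] := taylor_coef_bound n. Qed.
Let b_bound n : `|b n| <= K ^+ n. Proof. by have [] := taylor_coef_bound n. Qed.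

Lemma radius_scaled_le (t : R) : `|t| < rho -> K * `|t| <= 8^-1.
Proof.
by move=> tr; rewrite -ler_pdivlMl// -invfM mulrC ltW// mulrC.
Qed.

Lemma taylor_ode (t : R) : `|t| < rho ->
  is_derive t 1 X (- alpha * X t + delta * Y t) /\
  is_derive t 1 Y (- beta * Y t + X t ^+ 2).
Proof.
move=> tr; have Kt8 := radius_scaled_le tr.
have Kt4 : K * `|t| <= 4^-1 by apply: le_trans Kt8 _; rewrite lef_pV2 ?posrE// ler_nat.
have Kt1 : K * `|t| < 1 by apply: le_lt_trans Kt4 _; rewrite invf_lt1// ltr1n.
have cvga : (pseries a t @ \oo --> X t)%classic.
  apply: (@is_cvg_pseries_geometric _ _ 1 K) => //; [|exact: ltW].
  by move=> n; rewrite mul1r.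
have cvgb : (pseries b t @ \oo --> Y t)%classic.
  apply: (@is_cvg_pseries_geometric _ _ 1 K) => //; [|exact: ltW].
  by move=> n; rewrite mul1r.
have cvgq := cvg_cauchy_square a_bound (ltW K_gt0) Kt4.
split.
  have -> : - alpha * X t + delta * Y t = limn (pseries (pseries_diffs a) t).
    apply/esym/cvg_lim => //.
    have -> : pseries (pseries_diffs a) t =
       (fun n => - alpha * pseries a t n + delta * pseries b t n).
      apply/funext => n; rewrite /pseries /series/= !mulr_sumr -big_split/=.
      by apply: eq_bigr => i _; rewrite pseries_diffs_a; ring.
    by apply: cvgD; apply: cvgM => //; exact: cvg_cst.
  exact: is_derive_pseries_geometric a_bound K_gt0 tr.
have -> : - beta * Y t + X t ^+ 2 = limn (pseries (pseries_diffs b) t).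
  apply/esym/cvg_lim => //.
  have -> : pseries (pseries_diffs b) t =
     (fun n => - beta * pseries b t n + pseries (cauchy_square a) t n).
    apply/funext => n; rewrite /pseries /series/= !mulr_sumr -big_split/=.
    by apply: eq_bigr => i _; rewrite pseries_diffs_b; ring.
  by apply: cvgD => //; apply: cvgM => //; exact: cvg_cst.
exact: is_derive_pseries_geometric b_bound K_gt0 tr.
Qed.

Lemma taylor_le2 (t : R) : `|t| < rho -> `|X t| <= 2 /\ `|Y t| <= 2.
Proof.
move=> /radius_scaled_le Kt8.
have Kt2 : K * `|t| <= 2^-1 by apply: le_trans Kt8 _; rewrite lef_pV2 ?posrE// ler_nat.
by split; apply: lim_pseries_le2 (ltW K_gt0) Kt2.
Qed.

Lemma local_solution : exists b (z : R -> 'cV[R]_2),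
  solution_on (perturbed_rhs alpha beta gamma delta) b z /\ z 0 = cv2 x0 0.
Proof.
have rho_gt0 : 0 < rho by rewrite invr_gt0 mulr_gt0.
have rho_le1 : rho <= 1.
  by rewrite invf_le1 ?mulr_gt0//; apply: mulr_ege1 => //; rewrite ler1n.
exists rho%:E, (fun t => cv2 (X t) (Y t)); split; last first.
  by rewrite /X /Y !lim_pseries0.
have small (t : R) : 0 <= t -> t < rho -> `|t| < rho by move=> ? ?; rewrite ger0_norm.
split; first by rewrite lte_fin.
- move=> c [c0]; rewrite lte_fin => crho.
  (* |X|, |Y| <= 2 bounds the linear terms by 2 K and the square by 4. *)
  pose L := 2 * K + 4.
  have cr (t : R) : 0 <= t <= c -> `|t| < rho.
    by move=> /andP[t0 tc]; rewrite small// (le_lt_trans tc).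
  have LX t : 0 <= t <= c -> `|- alpha * X t + delta * Y t| <= L.
    move=> /cr /taylor_le2[Xt Yt]; rewrite (le_trans (ler_normD _ _))// !normrM normrN.
    rewrite (gtr0_norm alpha_gt0) (gtr0_norm delta_gt0).
    apply: (@le_trans _ _ (alpha * 2 + delta * 2)).
      by rewrite lerD// ler_wpM2l// ltW.
    by move: beta_gt0; rewrite /L /K; lra.
  have LY t : 0 <= t <= c -> `|- beta * Y t + X t ^+ 2| <= L.
    move=> /cr /taylor_le2[Xt Yt]; rewrite (le_trans (ler_normD _ _))// normrX normrM normrN.
    rewrite (gtr0_norm beta_gt0).
    apply: (@le_trans _ _ (beta * 2 + 2 ^+ 2)).
      apply: lerD; first by rewrite ler_wpM2l// ltW.
      by apply: lerXn2r => //; rewrite nnegrE.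
    by move: alpha_gt0 delta_gt0; rewrite /L /K expr2; lra.
  have L0 : 0 <= L by rewrite addr_ge0// mulr_ge0// ltW.
  apply: (lipschitz_abs_continuous L0) => l r l0 lr rc.
  rewrite [leLHS]/Num.Def.normr/= mx_normrE bigmax_le//.
    by rewrite mulr_ge0// subr_ge0.
  move=> [i j] _; rewrite !mxE/=; case: ifP => _.
    apply: (@derive_bounded_lipschitz _ X (fun t => - alpha * X t + delta * Y t) 0 c) => //.
    by move=> t /cr/taylor_ode[].
  apply: (@derive_bounded_lipschitz _ Y (fun t => - beta * Y t + X t ^+ 2) 0 c) => //.
  by move=> t /cr/taylor_ode[].
- apply: aeW => t [t0]; rewrite lte_fin => tr.
  have [dX dY] := taylor_ode (small _ t0 tr).
  have t1 : 0 <= t < 1 by rewrite t0 (lt_le_trans tr).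
  have [F0 F1] := perturbed_rhsE (cv2 (X t) (Y t)) (coef_mx_unit alpha beta gamma delta t1).
  have dz : derivable (fun t => cv2 (X t) (Y t)) t 1.
    apply/derivable_mxP => i j.
    rewrite (_ : (fun _ => _) = if i == 0 then X else Y); last first.
      by apply/funext => u; rewrite mxE; case: ifP.
    by case: ifP.
  apply: DeriveDef => //; rewrite derive_mx//.
  apply/matrixP => i j; rewrite mxE !ord1.
  rewrite (_ : (fun _ => _) = if i == 0 then X else Y); last first.
    by apply/funext => u; rewrite mxE; case: ifP.
  case: ifPn => [/eqP ->|i0].
    by rewrite F0 !mxE/=; apply: derive_val.
  have -> : i = 1.
    by apply/val_inj; case: i i0 => -[|[|//]].
  by rewrite F1 !mxE/=; apply: derive_val.
Qed.

End LocalSolution.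

(** * Maximal solutions and instability *)

Section MaximalExtension.
Variables (R : realType) (n : nat) (F : R -> 'cV[R]_n.+1 -> 'cV[R]_n.+1).

Let extends (p q : \bar R * (R -> 'cV[R]_n.+1)) :=
  (p.1 <= q.1)%E /\ forall t, time_interval p.1 t -> q.2 t = p.2 t.

Lemma time_intervalW (b b' : \bar R) t :
  (b <= b')%E -> time_interval b t -> time_interval b' t.
Proof. by move=> bb' [t0 tb]; split => //; exact: lt_le_trans bb'. Qed.

(** The members of a chain agree where they are defined, so they glue.  Each has
its own exceptional null set; the members selected by the rational numbers
below the supremum already cover the whole interval, which leaves a countable
union of null sets.  The point 0 is excluded since the members may differ at
negative times and derivatives are two-sided. *)
Lemma solution_chain_union (A : set (\bar R * (R -> 'cV[R]_n.+1))) p0 :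
  A p0 -> (forall p, A p -> solution_on F p.1 p.2) ->
  (forall p q, A p -> A q -> extends p q \/ extends q p) ->
  exists2 q, solution_on F q.1 q.2 & forall p, A p -> extends p q.
Proof.
move=> Ap0 solA totA.
have /choice[z zP] : forall t : R, exists v : 'cV[R]_n.+1,
    forall p, A p -> time_interval p.1 t -> v = p.2 t.
  move=> t.
  have [[p [Ap pt]]|no] := pselect (exists p, A p /\ time_interval p.1 t).
    exists (p.2 t) => q Aq qt.
    by have [[_ ->]|[_ ->]] := totA p q Ap Aq.
  by exists 0 => p Ap pt; exfalso; apply: no; exists p.
pose B := ereal_sup [set p.1 | p in A]%classic.
have pB p : A p -> (p.1 <= B)%E by move=> Ap; apply: ereal_sup_ubound; exists p.
have memB (t : R) : (t%:E < B)%E -> exists2 p, A p & (t%:E < p.1)%E.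
  by move=> /ereal_sup_gt[_ [p Ap <-] tp]; exists p.
exists (B, z); last by move=> p Ap; split => /=; [exact: pB|move=> t pt; exact: zP].
split => /=.
- by have [b0 _ _] := solA _ Ap0; exact: lt_le_trans b0 (pB _ Ap0).
- move=> c [c0 /memB[p Ap cp]]; have [_ acp _] := solA _ Ap.
  have := acp c (conj c0 cp); apply: eq_abs_continuous_on => t /andP[t0 tc].
  by apply/esym/zP => //; split => //; apply: le_lt_trans cp; rewrite lee_fin.
(* s enumerates, through the rationals, members reaching every t < B. *)
- have /choice[s sP] : forall k : nat, exists p, A p /\ forall q : rat,
      unpickle k = Some q -> ((ratr q)%:E < B)%E -> ((ratr q : R)%:E < p.1)%E.
    move=> k; case: (unpickle k) => [q|]; last by exists p0.
    have [qB|qB] := pselect ((ratr q)%:E < B)%E; last first.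
      by exists p0; split => // q' [<-] /qB.
    by have [p Ap qp] := memB _ qB; exists p; split => // q' [<-].
  have sol_s : {ae lebesgue_measure, forall t : R, forall k,
      time_interval (s k).1 t -> is_derive t 1 (s k).2 (F t ((s k).2 t))}.
    by apply: ae_foralln => k; have [Ak _] := sP k; have [] := solA _ Ak.
  apply: (ae_except_point (x := 0)) sol_s => t tn0 Ht [t0 tB].
  have {}t0 : 0 < t by rewrite lt_neqAle eq_sym tn0.
  (* q lies strictly between t and the end of some member of the chain. *)
  have [q tq qB] : exists2 q : rat, t < ratr q & ((ratr q)%:E < B)%E.
    have [p Ap tp] := memB _ tB.
    have [r tr rp] : exists2 r : R, t < r & (r%:E <= p.1)%E.
      case: (p.1) tp => [r| |]//; first by rewrite lte_fin; exists r.
      by exists (t + 1); [rewrite ltrDl|rewrite leey].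
    have [q] := rat_in_itvoo tr; rewrite in_itv/= => /andP[tq qr]; exists q => //.
    by rewrite (lt_le_trans _ (pB _ Ap))// (lt_le_trans _ rp)// lte_fin.
  have [Ak] := sP (pickle q); set p := s (pickle q) in Ak *.
  move=> /(_ q (pickleK q) qB) qp.
  have inp u : 0 < u -> u < ratr q -> time_interval p.1 u.
    by move=> u0 uq; split; [exact: ltW|apply: lt_trans qp; rewrite lte_fin].
  have dp := Ht (pickle q) (inp _ t0 tq).
  rewrite (zP t p Ak (inp _ t0 tq)).
  apply: near_eq_is_derive dp; near=> u.
  apply/esym/zP => //; apply: inp.
    by near: u; exact: lt_nbhsr.
  by near: u; exact: lt_nbhsl.
Unshelve. all: by end_near. Qed.

(** Zorn's lemma on the solutions with the same initial value, for the extension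
preorder: it is not antisymmetric, since values outside the interval of
existence are arbitrary. *)
Lemma maximal_extension b0 z0 : solution_on F b0 z0 ->
  exists b z, maximal_solution_on F b z /\ z 0 = z0 0.
Proof.
move=> sol0.
pose T := {p : \bar R * (R -> 'cV[R]_n.+1) |
  solution_on F p.1 p.2 /\ p.2 0 = z0 0}.
pose ext_rel (p q : T) := `[< extends (sval p) (sval q) >].
pose t0 : T := exist _ (b0, z0) (conj sol0 erefl).
have [||| p pmax] := @ZL_preorder T t0 ext_rel.
- by move=> p; apply/asboolP.
- move=> p q r /asboolP[pq Epq] /asboolP[qr Eqr]; apply/asboolP; split.
    exact: le_trans qr.
  by move=> t pt; rewrite Eqr ?Epq//; exact: time_intervalW pt.
- move=> A totA; have [[p0 Ap0]|A0] := pselect (exists p, A p); last first.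
    by exists t0 => p Ap; exfalso; apply: A0; exists p.
  have [|||q solq qP] := @solution_chain_union (sval @` A)%classic (sval p0).
  + by exists p0.
  + by move=> _ [p _ <-]; have [] := svalP p.
  + move=> _ _ [p Ap <-] [q Aq <-].
    by have [/asboolP|/asboolP] := totA p q Ap Aq; [left|right].
  + have q0 : q.2 0 = z0 0.
      have [[p0b _ _] <-] := svalP p0.
      have [_ ->//] : extends (sval p0) q by apply: qP; exists p0.
    by exists (exist _ q (conj solq q0)) => p Ap; apply/asboolP; apply: qP; exists p.
- have [solp p0] := svalP p; exists (sval p).1, (sval p).2; split => //; split => //.
  move=> b' w solw pb' Ew.
  have w0 : w 0 = z0 0 by rewrite Ew ?p0//; have [] := solp.
  have := pmax (exist _ (b', w) (conj solw w0)).
  case/(_ _)/asboolP => [|/= b'p _]; first exact/asboolP.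
  by apply/eqP; rewrite eq_le b'p.
Qed.

End MaximalExtension.

Theorem proposition33 (R : realType) (alpha beta gamma delta : R)
  (halpha : 0 < alpha) (hbeta : 0 < beta) (hgamma : 0 < gamma)
  (hdelta : 0 < delta)
  (hbeta_large : beta > 2 * gamma + 3 * alpha)
  (hgamma_large : gamma > 2 * alpha)
  (hdelta_ge1 : delta >= 1) :
  unstable (perturbed_rhs alpha beta gamma delta).
Proof.
move=> stable; have [eta eta0 etaP] := stable 1 ltr01.
pose x0 := Num.min 1 (eta / 2).
have x0_gt0 : 0 < x0 by rewrite lt_min ltr01 divr_gt0.
have x0_le1 : x0 <= 1 by rewrite ge_min lexx.
have x0_eta : x0 < eta by rewrite gt_min orbC ltr_pdivrMr// ltr_pMr// ltr1n.
have [b0 [z0 [sol0 z00]]] := local_solution gamma halpha hbeta hdelta x0_gt0 x0_le1.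
have [b [z [zmax]]] := maximal_extension sol0; rewrite z00 => z_init.
have x_init : z 0 0 0 = x0 by rewrite z_init mxE.
have y_init : z 0 1 0 = 0 by rewrite z_init mxE.
have [|b_oo zlt1] := etaP b z zmax.
  rewrite /euclidean_norm !big_ord_recl big_ord0 addr0.
  have -> : lift ord0 ord0 = 1 :> 'I_2 by apply: val_inj.
  by rewrite x_init y_init expr0n addr0 sqrtr_sqr gtr0_norm.
have [sol _] := zmax; rewrite b_oo in sol.
have [t t0] := solution_unbounded halpha hgamma hdelta hgamma_large sol
  x0_gt0 x_init y_init 1.
apply/negP; rewrite -leNgt ltW// (le_lt_trans _ (zlt1 t t0))//.
rewrite (le_trans (ler_norm _))// -sqrtr_sqr ler_sqrt; last first.
  by apply: sumr_ge0 => i _; exact: sqr_ge0.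
rewrite !big_ord_recl big_ord0 addr0.
have -> : lift ord0 ord0 = 1 :> 'I_2 by apply: val_inj.
by rewrite lerDr sqr_ge0.
Qed.
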